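(* Let $G$ and $\widetilde{G}$ be connected, undirected graphs with positive edge weights on the same vertex set $V$ (so that $\widetilde{G}$ is obtained from $G$ by deleting and/or reweighting edges, with no nodes merged), and let $\mathbf{L}_G$ and $\mathbf{L}_{\widetilde{G}}$ be their Laplacians. Let $\sigma>0$. If $d_h\big(\mathbf{L}_G,\mathbf{L}_{\widetilde{G}}\big)\le \ln(\sigma)$, then $\widetilde{G}$ is a $\sigma$-spectral approximation of $G$, i.e. $$\frac{1}{\sigma}\,\mathbf{x}^{\top}\mathbf{L}_G\mathbf{x}\;\le\;\mathbf{x}^{\top}\mathbf{L}_{\widetilde{G}}\mathbf{x}\;\le\;\sigma\,\mathbf{x}^{\top}\mathbf{L}_G\mathbf{x}\qquad\text{for all }\mathbf{x}\in\mathbb{R}^{|V|}.$$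
   Context: For a weighted undirected graph with positive edge weights, the Laplacian is $\mathbf{L}=\mathbf{D}-\mathbf{A}$, where $\mathbf{A}$ is the weighted adjacency matrix and $\mathbf{D}$ the diagonal matrix of weighted degrees; for a connected graph, $\mathbf{x}^\top\mathbf{L}\mathbf{x}>0$ for every nonzero $\mathbf{x}$ orthogonal to the all-ones vector $\mathbf{1}$. The hyperbolic distance between two such Laplacians $\mathbf{L}_0,\mathbf{L}_1$ on the same vertex set is defined as $$d_h(\mathbf{L}_0,\mathbf{L}_1)=\sup_{\mathbf{x}\neq \mathbf{0},\ \mathbf{1}^\top\mathbf{x}=0}\ \operatorname{arccosh}\!\left(1+\frac{\|(\mathbf{L}_0-\mathbf{L}_1)\mathbf{x}\|_2^2\,\|\mathbf{x}\|_2^2}{2\,(\mathbf{x}^\top\mathbf{L}_0\mathbf{x})(\mathbf{x}^\top\mathbf{L}_1\mathbf{x})}\right).$$ *)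

(* Defs.v *)
From mathcomp Require Import all_boot all_order all_algebra.
From mathcomp Require Import all_classical all_reals all_analysis.
From mathcomp Require Import ring lra.

Set Implicit Arguments.
Unset Strict Implicit.
Unset Printing Implicit Defensive.

Import Order.TTheory GRing.Theory Num.Theory.

Local Open Scope ring_scope.

(* [weight] is only meaningful on edges; its values elsewhere are junk that no
   definition below ever reads. *)
Record wgraph (R : realType) (n : nat) := WGraph {
  edge : rel 'I_n;
  weight : 'I_n -> 'I_n -> R;
  edge_sym : symmetric edge;
  edge_irrefl : irreflexive edge;
  weight_sym : forall i j, edge i j -> weight i j = weight j i;
  weight_gt0 : forall i j, edge i j -> 0 < weight i j
}.

Definition connected_graph (R : realType) (n : nat) (G : wgraph R n) : Prop :=
  forall i j : 'I_n, connect (edge G) i j.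

Definition adjacency (R : realType) (n : nat) (G : wgraph R n) : 'M[R]_n :=
  \matrix_(i, j) (if edge G i j then weight G i j else 0).

Definition degrees (R : realType) (n : nat) (G : wgraph R n) : 'rV[R]_n :=
  \row_i \sum_j adjacency G i j.

Definition laplacian (R : realType) (n : nat) (G : wgraph R n) : 'M[R]_n :=
  diag_mx (degrees G) - adjacency G.

Definition qform (R : realType) (n : nat) (L : 'M[R]_n) (x : 'cV[R]_n) : R :=
  (x^T *m L *m x) 0 0.

(* Needed because the norm [`|x|] that the library puts on matrices is the
   maximum norm. *)
Definition norm2 (R : realType) (n : nat) (x : 'cV[R]_n) : R :=
  Num.sqrt (\sum_i x i 0 ^+ 2).

Definition ones (R : realType) (n : nat) : 'cV[R]_n := const_mx 1.

Definition cosh (R : realType) (t : R) : R := (expR t + expR (- t)) / 2.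

Definition arccosh (R : realType) (y : R) : R :=
  ln (y + Num.sqrt (y ^+ 2 - 1)).

(* On [1, +oo[, [arccosh] is the inverse of [cosh] restricted to [0, +oo[. *)
Lemma arccosh_ge0 (R : realType) (y : R) : 1 <= y -> 0 <= arccosh y.
Proof.
move=> y1; apply: ln_ge0.
by have := sqrtr_ge0 (y ^+ 2 - 1); lra.
Qed.

Lemma arccoshK (R : realType) (y : R) : 1 <= y -> cosh (arccosh y) = y.
Proof.
move=> y1; rewrite /cosh /arccosh.
have y2 : 0 <= y ^+ 2 - 1 by nra.
have := sqrtr_ge0 (y ^+ 2 - 1); have := sqr_sqrtr y2.
set s := Num.sqrt _ => s2 s0.
have z0 : 0 < y + s by lra.
rewrite expRN lnK ?posrE//.
have -> : (y + s)^-1 = y - s.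
  apply: (mulfI (lt0r_neq0 z0)); rewrite divff ?lt0r_neq0//.
  have -> : (y + s) * (y - s) = y ^+ 2 - s ^+ 2 by ring.
  by rewrite s2; ring.
by field.
Qed.

(* Extended-real supremum: no boundedness side condition is built in, and the
   value is -oo when there is no nonzero x orthogonal to 1, i.e. for n <= 1. *)
Definition hyp_dist (R : realType) (n : nat) (L0 L1 : 'M[R]_n) : \bar R :=
  ereal_sup [set (arccosh
      (1 + (norm2 ((L0 - L1) *m x) ^+ 2 * norm2 x ^+ 2)
           / (2 * (qform L0 x * qform L1 x))))%:E
    | x in [set x : 'cV[R]_n | x != 0 /\ (ones R n)^T *m x = 0]]%classic.

Definition spectral_approximation (R : realType) (n : nat) (sigma : R)
    (G G' : wgraph R n) : Prop :=
  forall x : 'cV[R]_n,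
    1 / sigma * qform (laplacian G) x <= qform (laplacian G') x /\
    qform (laplacian G') x <= sigma * qform (laplacian G) x.

(* Main.v *)
(* Put a = x^T L_G x and b = x^T L_G' x.  By Cauchy-Schwarz,
   (a - b)^2 <= |(L_G - L_G') x|^2 |x|^2, and 1 + (a - b)^2 / (2ab) is
   (a/b + b/a) / 2 = cosh (ln (a/b)); so the distance dominates |ln (a/b)| for
   every nonzero x orthogonal to 1.  Both quadratic forms are positive there by
   connectedness and invariant under adding constants to x. *)

Require Import Defs.
From mathcomp Require Import all_boot all_order all_algebra.
From mathcomp Require Import all_classical all_reals all_analysis.
From mathcomp Require Import ring lra.

Set Implicit Arguments.
Unset Strict Implicit.
Unset Printing Implicit Defensive.

Import Order.TTheory GRing.Theory Num.Theory.

Local Open Scope ring_scope.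

(** Lagrange's identity writes twice the gap between the sides as a sum of squares, which avoids
    dividing by a norm that may vanish. *)
Lemma sum_cauchy_schwarz (R : realDomainType) (I : finType) (u v : I -> R) :
  (\sum_i u i * v i) ^+ 2 <= (\sum_i u i ^+ 2) * (\sum_i v i ^+ 2).
Proof.
have lagrange_identity : (\sum_i \sum_j (u i * v j - u j * v i) ^+ 2) =
    2 * ((\sum_i u i ^+ 2) * (\sum_i v i ^+ 2) - (\sum_i u i * v i) ^+ 2).
  transitivity (\sum_i \sum_j (u i ^+ 2 * v j ^+ 2 + v i ^+ 2 * u j ^+ 2
      + - 2 * (u i * v i) * (u j * v j))).
    by apply: eq_bigr => i _; apply: eq_bigr => j _; ring.
  under eq_bigr do rewrite !big_split /= -!mulr_sumr.
  by rewrite !big_split /= -!mulr_suml -mulr_sumr; ring.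
have : 0 <= \sum_i \sum_j (u i * v j - u j * v i) ^+ 2.
  by apply: sumr_ge0 => i _; apply: sumr_ge0 => j _; exact: sqr_ge0.
by rewrite lagrange_identity pmulr_rge0 ?subr_ge0.
Qed.

Section Laplacian.
Variables (R : realType) (n : nat).
Implicit Types (G : wgraph R n) (x : 'cV[R]_n) (L : 'M[R]_n).

Lemma qformE L x : qform L x = \sum_i x i 0 * (L *m x) i 0.
Proof.
by rewrite /qform -mulmxA mxE; apply: eq_bigr => i _; rewrite mxE.
Qed.

Lemma norm2_sqr x : norm2 x ^+ 2 = \sum_i x i 0 ^+ 2.
Proof. by rewrite sqr_sqrtr// sumr_ge0// => i _; exact: sqr_ge0. Qed.

Lemma qform_cauchy_schwarz L x :
  qform L x ^+ 2 <= norm2 (L *m x) ^+ 2 * norm2 x ^+ 2.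
Proof. by rewrite qformE !norm2_sqr mulrC sum_cauchy_schwarz. Qed.

Lemma qformB L L' x : qform (L - L') x = qform L x - qform L' x.
Proof. by rewrite /qform mulmxBr mulmxBl !mxE. Qed.

Lemma adjacency_sym G i j : adjacency G i j = adjacency G j i.
Proof.
by rewrite !mxE (edge_sym G j); case: ifP => // e; exact: weight_sym.
Qed.

Lemma adjacency_ge0 G i j : 0 <= adjacency G i j.
Proof. by rewrite mxE; case: ifP => // e; exact/ltW/weight_gt0. Qed.

Lemma mul_laplacian G x i :
  (laplacian G *m x) i 0 = \sum_j adjacency G i j * (x i 0 - x j 0).
Proof.
rewrite mulmxBl !mxE.
under eq_bigr do rewrite mxE.
rewrite (bigD1 i) //= eqxx mulr1n big1 ?addr0; last first.
  by move=> j /negPf ji; rewrite eq_sym ji mulr0n mul0r.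
rewrite mxE mulr_suml -sumrB.
by apply: eq_bigr => j _; rewrite mulrBr.
Qed.

(** Adding to the double sum its copy with [i] and [j] exchanged completes the square. The factor 2
    appears because each edge is met in both orientations. *)
Lemma qform_laplacian G x :
  2 * qform (laplacian G) x =
  \sum_i \sum_j adjacency G i j * (x i 0 - x j 0) ^+ 2.
Proof.
have qE : qform (laplacian G) x =
    \sum_i \sum_j adjacency G i j * (x i 0 * (x i 0 - x j 0)).
  rewrite qformE; apply: eq_bigr => i _; rewrite mul_laplacian mulr_sumr.
  by apply: eq_bigr => j _; rewrite mulrCA.
rewrite mulr_natl mulr2n {2}qE exchange_big qE -big_split /=.
apply: eq_bigr => i _; rewrite -big_split /=; apply: eq_bigr => j _.
by rewrite (adjacency_sym G j i); ring.
Qed.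

Lemma qform_laplacian_ge0 G x : 0 <= qform (laplacian G) x.
Proof.
suff : 0 <= 2 * qform (laplacian G) x by rewrite pmulr_rge0.
rewrite qform_laplacian; apply: sumr_ge0 => i _; apply: sumr_ge0 => j _.
by rewrite mulr_ge0 ?sqr_ge0 ?adjacency_ge0.
Qed.

(** The sum over edges sees only differences of entries, where a constant cancels. This allows the
    reduction to vectors orthogonal to [ones]. *)
Lemma qform_laplacian_shift G x c :
  qform (laplacian G) (x + const_mx c) = qform (laplacian G) x.
Proof.
suff : 2 * qform (laplacian G) (x + const_mx c) = 2 * qform (laplacian G) x.
  by apply: mulfI; rewrite pnatr_eq0.
rewrite !qform_laplacian; apply: eq_bigr => i _; apply: eq_bigr => j _.
by rewrite !mxE; congr (_ * _ ^+ 2); ring.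
Qed.

Lemma qform_laplacian0 G : qform (laplacian G) 0 = 0.
Proof. by rewrite /qform mulmx0 mxE. Qed.

(** A vanishing sum of nonnegative terms has only zero terms, so [x] agrees at the ends of each
    edge, and then along any path. *)
Lemma qform_laplacian_eq0 G x : connected_graph G ->
  qform (laplacian G) x = 0 -> forall i j, x i 0 = x j 0.
Proof.
move=> connG q0 i j.
have edge_eq k l : edge G k l -> x k 0 = x l 0.
  move=> e.
  have term_ge0 a b : 0 <= adjacency G a b * (x a 0 - x b 0) ^+ 2.
    by rewrite mulr_ge0 ?sqr_ge0 ?adjacency_ge0.
  have /psumr_eq0P sum0 :
      \sum_a \sum_b adjacency G a b * (x a 0 - x b 0) ^+ 2 = 0.
    by rewrite -qform_laplacian q0 mulr0.
  have /psumr_eq0P row0 := sum0 (fun a _ => sumr_ge0 _ (fun b _ => term_ge0 a b))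
    k isT.
  have /eqP := row0 (fun b _ => term_ge0 k b) l isT.
  by rewrite mxE e mulf_eq0 gt_eqF ?weight_gt0//= sqrf_eq0 subr_eq0 => /eqP.
have /connectP [p pth ->] := connG i j.
elim: p i pth => //= k p IH i /andP[/edge_eq -> pth].
exact: IH.
Qed.

Lemma qform_laplacian_gt0 G x : connected_graph G ->
  x != 0 -> (ones R n)^T *m x = 0 -> 0 < qform (laplacian G) x.
Proof.
move=> connG x0 x1; rewrite lt0r qform_laplacian_ge0 andbT.
apply: contraNneq x0 => /(qform_laplacian_eq0 connG) xc.
have sum0 : \sum_j x j 0 = 0.
  transitivity (((ones R n)^T *m x) 0 0); last by rewrite x1 mxE.
  by rewrite mxE; apply: eq_bigr => j _; rewrite !mxE mul1r.
apply/eqP/matrixP => i k; rewrite !ord1 mxE.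
move: sum0; under eq_bigr do rewrite (xc _ i).
rewrite sumr_const card_ord => /eqP; rewrite mulrn_eq0 => /orP[|/eqP//].
(* The index [i] itself rules out [n = 0]. *)
by rewrite -leqn0 leqNgt (leq_ltn_trans _ (ltn_ord i)).
Qed.

End Laplacian.

(** The hypothesis reads [cosh (ln r) <= y]. Since [ln r] may be negative, only one direction of the
    comparison is claimed. *)
Lemma ln_le_arccosh (R : realType) (r y : R) :
  0 < r -> (r + r^-1) / 2 <= y -> ln r <= arccosh y.
Proof.
move=> r0 ry.
have rV : r * r^-1 = 1 by rewrite divff ?gt_eqF.
have rV0 : 0 < r^-1 by rewrite invr_gt0.
(* This is [cosh^2 - 1 = sinh^2] at [ln r]; the halves [(r + r^-1) / 2] and [(r - r^-1) / 2] then
   add up to [r]. *)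
have sq : ((r - r^-1) / 2) ^+ 2 <= y ^+ 2 - 1 by nra.
have := ler_wsqrtr sq; rewrite sqrtr_sqr => sqrt_le.
have := ler_norm ((r - r^-1) / 2) => normr_le.
by rewrite ler_ln ?posrE//; lra.
Qed.

(** Equality holds for [D = (a - b) ^+ 2]; the right side grows with [D], which will be the
    Cauchy-Schwarz bound. *)
Lemma ratio_bound (R : realType) (a b D : R) :
  0 < a -> 0 < b -> (a - b) ^+ 2 <= D ->
  (a / b + (a / b)^-1) / 2 <= 1 + D / (2 * (a * b)).
Proof.
move=> a0 b0 abD.
have -> : (a / b + (a / b)^-1) / 2 = 1 + (a - b) ^+ 2 / (2 * (a * b)).
  by field; rewrite !gt_eqF.
by rewrite lerD2l ler_pM2r// invr_gt0 !mulr_gt0.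
Qed.

Lemma qform_ratio_le (R : realType) (n : nat) (L0 L1 : 'M[R]_n) (sigma : R)
    (x : 'cV[R]_n) :
  0 < sigma -> (hyp_dist L0 L1 <= (ln sigma)%:E)%E ->
  x != 0 -> (ones R n)^T *m x = 0 -> 0 < qform L0 x -> 0 < qform L1 x ->
  qform L0 x <= sigma * qform L1 x /\ qform L1 x <= sigma * qform L0 x.
Proof.
move=> s0 dist_le x0 x1 q0 q1.
set y := 1 + (norm2 ((L0 - L1) *m x) ^+ 2 * norm2 x ^+ 2)
           / (2 * (qform L0 x * qform L1 x)).
have y_le : arccosh y <= ln sigma.
  rewrite -lee_fin; apply: le_trans dist_le.
  by apply: ereal_sup_ubound; exists x.
have := qform_cauchy_schwarz (L0 - L1) x; rewrite qformB => cs.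
have ratio_le r : 0 < r -> (r + r^-1) / 2 <= y -> r <= sigma.
  by move=> r0 /(ln_le_arccosh r0)/le_trans/(_ y_le); rewrite ler_ln ?posrE.
have y_ge := ratio_bound q0 q1 cs.
rewrite -!ler_pdivrMr//; split; apply: ratio_le; rewrite ?divr_gt0//.
(* The bound is symmetric under inverting the ratio, so [y_ge] also serves the second inequality. *)
by rewrite -(invf_div (qform L0 x)) invrK addrC.
Qed.

Theorem theorem1 (R : realType) (n : nat) (G G' : wgraph R n) (sigma : R)
    (connG : connected_graph G) (connG' : connected_graph G')
    (edgeG'G : subrel (edge G') (edge G))
    (sigma_gt0 : 0 < sigma)
    (dist_le : (hyp_dist (laplacian G) (laplacian G') <= (ln sigma)%:E)%E) :
  spectral_approximation sigma G G'.
Proof.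
(* Subtracting the mean [m] projects [x] onto the complement of [ones] without changing either
   form. *)
move=> x; set m := (\sum_i x i 0) / n%:R.
rewrite -(qform_laplacian_shift G x (- m)) -(qform_laplacian_shift G' x (- m)).
set z := x + const_mx (- m).
(* For constant [x] the distance gives no information, but both forms vanish. *)
have [->|z0] := eqVneq z 0; first by rewrite !qform_laplacian0 !mulr0.
have z1 : (ones R n)^T *m z = 0.
  apply/matrixP => i j; rewrite !ord1 !mxE.
  under eq_bigr do rewrite !mxE mul1r.
  rewrite big_split /= sumr_const card_ord -mulr_natr /m.
  (* For [n = 0] the factor [n%:R] cannot be cancelled, but the sum of entries is empty. *)
  have [n0|n_neq0] := eqVneq n 0%N; last first.
    by rewrite mulNr divfK ?pnatr_eq0// subrr.
  rewrite big1 ?mul0r ?oppr0 ?mul0r ?addr0// => k _.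
  by have := ltn_ord k; rewrite [X in (_ < X)%N]n0.
have [] := qform_ratio_le sigma_gt0 dist_le z0 z1
  (qform_laplacian_gt0 connG z0 z1) (qform_laplacian_gt0 connG' z0 z1).
by rewrite mul1r ler_pdivrMl.
Qed.
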